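(* Let $n\ge 1$ and $\alpha\in(0,1)$, and suppose assumptions A.1, A.2 and A.3 (stated in the context) hold. Consider the following two-stage procedure (Procedure 1) for testing the $2n$ hypotheses in $\mathcal{F}_1=\{H_{ij}: i=1,\dots,n,\ j=1,2\}$. Stage 1: reject all hypotheses whose $p$-values are $\le \alpha/n$, and let $r$ be the total number of rejections at this stage; if $r=n$, stop. Stage 2: otherwise, among the remaining hypotheses reject those whose $p$-values are $\le \alpha/(n-r)$. Then: (i) The procedure strongly controls $\mathrm{FWER}_{\mathcal{F}_1}$ at level $\frac{\alpha}{1-\alpha/n}$; that is, for every parameter vector $\theta$, $\mathrm{FWER}_{\mathcal{F}_1}(\theta)\le \frac{\alpha}{1-\alpha/n}$. (ii) $\limsup_{n\to\infty}\mathrm{FWER}_{\mathcal{F}_1}\le\alpha$, i.e. for any sequence of such testing problems indexed by $n$ (each satisfying A.1--A.3, with $\alpha$ fixed) and any parameter vectors, the procedure asymptotically controls $\mathrm{FWER}_{\mathcal{F}_1}$ at level $\alpha$. Moreover, if $\alpha$ is replaced by $\frac{\alpha}{1+\alpha/n}$ in the critical constants of both stages, then the resulting procedure (Procedure $1'$) strongly controls $\mathrm{FWER}_{\mathcal{F}_1}$ at level $\alpha$ for every finite $n$; that is, $\mathrm{FWER}_{\mathcal{F}_1}(\theta)\le\alpha$ for every $\theta$.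
   Context: Setting. $T_1,\dots,T_n$ are real-valued test statistics whose joint law $\mathrm{Pr}_\theta$ depends on an unknown vector $\theta=(\theta_1,\dots,\theta_n)$ of real parameters. $T_i$ has cumulative distribution function $F_{i,\theta_i}$ depending only on $\theta_i$; $F_{i,0}$ is continuous and symmetric about zero, $F_{i,0}(-t)=1-F_{i,0}(t)$ for all $t$; and $F_{i,\theta_i}(t)$ is non-increasing in $\theta_i$ for each fixed $t$. Hypotheses and $p$-values. For $i=1,\dots,n$: $H_{i1}:\theta_i\le 0$ (versus $\theta_i>0$), with $p$-value $1-F_{i,0}(T_i)$, and $H_{i2}:\theta_i>0$ (versus $\theta_i<0$), with $p$-value $F_{i,0}(T_i)$. Under any $\theta$ exactly one of $H_{i1},H_{i2}$ is true. Let $H_i$ denote the true one and $H_{n+i}$ the false one, with $p$-values $P_i$ and $P_{n+i}=1-P_i$; thus $P_i=1-F_{i,0}(T_i)$ if $\theta_i\le 0$ and $P_i=F_{i,0}(T_i)$ if $\theta_i>0$. Put $I_0=\{1,\dots,n\}$ (indices of the true nulls). The procedures use only the $2n$ $p$-values and not the knowledge of which hypotheses are true. Error rate. $V_1$ is the number of true hypotheses of $\mathcal{F}_1$ that are rejected, and $\mathrm{FWER}_{\mathcal{F}_1}(\theta)=\mathrm{Pr}_\theta\{V_1\ge 1\}$. Assumptions. A.1: for each $i\in I_0$ and each $\theta_i$, $\mathrm{Pr}_{\theta_i}\{P_i\le p\}\le p$ for all $0\le p\le 1$, with equality when $\theta_i=0$ (i.e. $P_i\sim U(0,1)$ when $\theta_i=0$).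 A.2: for each $i\in I_0$ and each $\theta_i$, $\mathrm{Pr}_{\theta_i}\{P_i\le p\mid P_i\le p'\}\le \mathrm{Pr}_{\theta_i=0}\{P_i\le p\mid P_i\le p'\}$ for all $0\le p\le p'\le 1$ (whenever the conditioning events have positive probability). On the right-hand side $P_i$ is the same function of $T_i$ as on the left and $T_i\sim F_{i,0}$, so the right-hand side equals $p/p'$. A.3: $T_1,\dots,T_n$ are mutually independent. *)

(* Defs.v *)
From HB Require Import structures.
From mathcomp Require Import all_boot all_order all_algebra.
From mathcomp Require Import all_classical all_reals all_analysis.
Set Implicit Arguments.
Unset Strict Implicit.
Unset Printing Implicit Defensive.
Import Order.TTheory GRing.Theory Num.Theory.
Import numFieldNormedType.Exports.
Local Open Scope classical_set_scope.
Local Open Scope ring_scope.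

(* MathComp-Analysis; the parameter vector ranges over all of R^n and the
   statistics live on an arbitrary sample space. *)
Record testing_model (R : realType) (n : nat) := TestingModel {
  tm_display : measure_display;
  Omega : measurableType tm_display;
  Pr : ('I_n -> R) -> probability Omega R;
  stat : 'I_n -> {mfun Omega >-> R};
  F : 'I_n -> R -> R -> R;
  cdf_stat : forall (theta : 'I_n -> R) (i : 'I_n) (t : R),
    cdf (stat i : {RV (Pr theta) >-> R}) t = (F i (theta i) t)%:E;
  F0_continuous : forall i : 'I_n, continuous (F i 0);
  F0_symmetric : forall (i : 'I_n) (t : R), F i 0 (- t) = 1 - F i 0 t;
  F_nonincreasing : forall (i : 'I_n) (t : R),
    {homo (fun x : R => F i x t) : x y / x <= y >-> y <= x}
}.

(* (i, false) stands for H_i1 : theta_i <= 0, and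
   (i, true) for H_i2 : theta_i > 0; the family F_1 is the whole type. *)
Definition hyp (n : nat) : finType := ('I_n * bool)%type.

Definition hyp_holds (R : realType) (n : nat) (theta : 'I_n -> R)
    (h : hyp n) : bool :=
  if h.2 then 0 < theta h.1 else theta h.1 <= 0.

Definition true_hyp (R : realType) (n : nat) (theta : 'I_n -> R)
    (i : 'I_n) : hyp n :=
  if theta i <= 0 then (i, false) else (i, true).

Definition pvalue (R : realType) (n : nat) (M : testing_model R n)
    (h : hyp n) (w : Omega M) : R :=
  if h.2 then F M h.1 0 (stat M h.1 w) else 1 - F M h.1 0 (stat M h.1 w).

(* P_i, as a function on the sample space; theta only selects which of
   H_i1, H_i2 is the true one. *)
Definition true_pvalue (R : realType) (n : nat) (M : testing_model R n)
    (theta : 'I_n -> R) (i : 'I_n) (w : Omega M) : R :=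
  pvalue (true_hyp theta i) w.

Definition pvalue_le (R : realType) (n : nat) (M : testing_model R n)
    (theta : 'I_n -> R) (i : 'I_n) (q : R) : set (Omega M) :=
  [set w | true_pvalue theta i w <= q].
Arguments pvalue_le {R n} M theta i q.

(* Only used when P B > 0. *)
Definition cond_pr d (T : measurableType d) (R : realType)
    (P : probability T R) (A B : set T) : R :=
  fine (P (A `&` B)) / fine (P B).

Definition mutually_independent d (T : measurableType d) (R : realType)
    (P : probability T R) (I : finType) (X : I -> {mfun T >-> R}) : Prop :=
  forall (J : {set I}) (B : I -> set R), (forall i, measurable (B i)) ->
    P (\bigcap_(i in [set` J]) (X i @^-1` B i)) =
    (\prod_(i in J) P (X i @^-1` B i))%E.

Definition A1 (R : realType) (n : nat) (M : testing_model R n) : Prop :=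
  forall (theta : 'I_n -> R) (i : 'I_n) (p : R), 0 <= p <= 1 ->
    (Pr M theta (pvalue_le M theta i p) <= p%:E)%E /\
    (theta i = 0 -> Pr M theta (pvalue_le M theta i p) = p%:E).

(* On the right-hand side P_i is still the p-value selected by theta; only the
   law is changed, to one under which the i-th parameter is 0.  The law of T_i
   depends on the i-th parameter only, so the other coordinates of theta0 are
   immaterial. *)
Definition A2 (R : realType) (n : nat) (M : testing_model R n) : Prop :=
  forall (theta theta0 : 'I_n -> R) (i : 'I_n) (p p' : R),
    theta0 i = 0 -> 0 <= p -> p <= p' -> p' <= 1 ->
    let Ple := pvalue_le M theta i in
    (0 < Pr M theta (Ple p'))%E -> (0 < Pr M theta0 (Ple p'))%E ->
    cond_pr (Pr M theta) (Ple p) (Ple p')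
      <= cond_pr (Pr M theta0) (Ple p) (Ple p').

Definition A3 (R : realType) (n : nat) (M : testing_model R n) : Prop :=
  forall theta : 'I_n -> R, mutually_independent (Pr M theta) (stat M).

Definition procedure (R : realType) (n : nat) : Type :=
  (hyp n -> R) -> {set hyp n}.

Definition stage1 (R : realType) (n : nat) (a : R) (p : hyp n -> R) :
    {set hyp n} :=
  [set h | p h <= a / n%:R]%SET.

(* The subtraction n - r is taken in R: for n = 1 and a >= 1/2 both hypotheses
   may be rejected at stage 1, so that r = 2 > n; none then remains. *)
Definition procedure1 (R : realType) (n : nat) (a : R) : procedure R n :=
  fun p =>
    let R1 := stage1 a p in
    let r := #|R1| in
    if r == n then R1
    else (R1 :|: [set h in ~: R1 | p h <= a / (n%:R - r%:R)])%SET.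

Definition V1 (R : realType) (n : nat) (M : testing_model R n)
    (proc : procedure R n) (theta : 'I_n -> R) (w : Omega M) : nat :=
  #|[set h in proc (fun h => pvalue h w) | hyp_holds theta h]%SET|.

Definition FWER (R : realType) (n : nat) (M : testing_model R n)
    (proc : procedure R n) (theta : 'I_n -> R) : \bar R :=
  Pr M theta [set w | (1 <= V1 proc theta w)%N].

Definition strongly_controls_FWER (R : realType) (n : nat)
    (M : testing_model R n) (proc : procedure R n) (level : R) : Prop :=
  forall theta : 'I_n -> R, (FWER M proc theta <= level%:E)%E.

(* Main.v *)
(* Put c = alpha / n, let P_i be the p-value of the i-th true hypothesis, and
   K = {i : P_i < 1 - c}.  If 1 - c <= alpha the bound alpha / (1 - c) is at
   least 1.  Otherwise, if no true hypothesis falls at stage 1, the false ones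
   rejected there are exactly those with P_i >= 1 - c, so that n - r = #|K|:
   in every case a true rejection forces P_i <= alpha / #|K| for some i in K.
   Assumptions A.1 and A.2 give
     Pr (P_i <= p) (1 - c) <= p Pr (P_i < 1 - c)   for p < 1 - c,
   hence, splitting over the values of K and using independence, the error rate
   is at most the sum over K and over i in K of
     alpha / (#|K| (1 - c)) Pr (K),
   that is, at most alpha / (1 - c).  Procedure 1' is this bound at level
   a = alpha / (1 + alpha / n), for which a / (1 - a / n) = alpha. *)
Require Import Defs.
From HB Require Import structures.
From mathcomp Require Import all_boot all_order all_algebra.
From mathcomp Require Import all_classical all_reals all_analysis.
From mathcomp Require Import measurable_realfun ring lra.
Import Order.TTheory GRing.Theory Num.Theory.
Import numFieldNormedType.Exports.
Local Open Scope classical_set_scope.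
Local Open Scope ring_scope.

(** * Events indexed by finite sets, and a union bound under independence *)

Lemma measurable_preimage {d d'} {T : measurableType d}
    {U : measurableType d'} (f : T -> U) (A : set U) :
  measurable_fun [set: T] f -> measurable A -> measurable (f @^-1` A).
Proof. by move=> mf mA; rewrite -[X in measurable X]setTI; exact: mf. Qed.

(** A random subset of a finite type takes finitely many values [S], so the event splits into
    finitely many pieces on which the subset is constant. This serves for rejection sets. *)
Lemma measurable_finset_pred {d} {T : measurableType d} {I : finType}
    (b : T -> I -> bool) (Q : {set I} -> set T) :
  (forall i, measurable [set w | b w i]) -> (forall S, measurable (Q S)) ->
  measurable [set w | Q [set i | b w i]%SET w].
Proof.
move=> mb mQ.
have -> : [set w | Q [set i | b w i]%SET w] =
    \bigcup_(S in [set: {set I}])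
      ((\bigcap_(i in [set: I]) [set w | b w i = (i \in S)]) `&` Q S).
  apply/seteqP; split=> w /=.
    by move=> Qw; exists [set i | b w i]%SET => //; split=> // i _ /=; rewrite inE.
  move=> [S _ [bS QS]]; suff -> : [set i | b w i]%SET = S by [].
  by apply/setP => i; rewrite inE; apply: bS.
apply: fin_bigcup_measurable => [|S _]; first exact: finite_finset.
apply: measurableI => //; apply: fin_bigcap_measurable => [|i _].
  exact: finite_finset.
case: (i \in S); first exact: mb.
rewrite (_ : mkset _ = ~` [set w | b w i]); first exact/measurableC/mb.
by apply/seteqP; split=> w /=; [move=> ->|move/negP/negbTE].
Qed.

Lemma measure_bigsetU_le {d} {T : measurableType d} {R : realType}
    (mu : {measure set T -> \bar R}) {I : Type} (r : seq I) (Q : pred I)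
    (A : I -> set T) :
  (forall i, measurable (A i)) ->
  (mu (\big[setU/set0]_(i <- r | Q i) A i) <= \sum_(i <- r | Q i) mu (A i))%E.
Proof.
move=> mA; elim: r => [|i r IH]; first by rewrite !big_nil measure0.
rewrite !big_cons; case: (Q i) => //.
apply: le_trans; first by apply: measureU2 => //; exact: bigsetU_measurable.
by rewrite leeD2l.
Qed.

(* With [K] the set of [j] such that [X j] lands in [B j], each member of [K]
   contributes at most [b / #|K|] times the probability of that value of [K]. *)
Lemma independent_stepdown_bound {d} {T : measurableType d} {R : realType}
    (P : probability T R) {I : finType} (X : I -> {mfun T >-> R})
    (B : I -> set R) (D : I -> nat -> set R) (b : R) (E : set T) :
  mutually_independent P X ->
  (forall i, measurable (B i)) -> (forall i k, measurable (D i k)) ->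
  0 <= b ->
  (forall i k, (0 < k)%N ->
     fine (P (X i @^-1` D i k)) <= b / k%:R * fine (P (X i @^-1` B i))) ->
  measurable E ->
  (forall w, E w -> exists2 i, B i (X i w) &
     D i #|[set j | X j w \in B j]%SET| (X i w)) ->
  (P E <= b%:E)%E.
Proof.
move=> indX mB mD b0 leDB mE EW.
(* [C K i] below fixes the membership pattern [K] at every coordinate except [i], where it asks for
   [D i #|K|] instead of [B i]. It constrains each coordinate separately, so independence turns its
   probability into a product. *)
pose Y (K : {set I}) i j :=
  if j == i then D i #|K| else if j \in K then B j else ~` B j.
have mY K i j : measurable (Y K i j).
  by rewrite /Y; case: ifP => // _; case: ifP => // _; exact: measurableC.
pose C K i := \bigcap_(j in [set` [set: I]%SET]) (X j @^-1` Y K i j).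
have mpre j A : measurable A -> measurable (X j @^-1` A).
  exact: (measurable_preimage _ _ (measurable_funPT (X j))).
have mC K i : measurable (C K i).
  apply: fin_bigcap_measurable => [|j _]; first exact: finite_finset.
  exact/mpre.
pose s j := fine (P (X j @^-1` B j)).
have fP A : measurable A -> P A \is a fin_num by move=> mA; exact: fin_num_measure.
(* By independence, [wt K] is the probability that the random set equals [K]. *)
pose wt (K : {set I}) := \prod_j (if j \in K then s j else 1 - s j).
have s0 j : 0 <= s j by exact: fine_ge0.
have s1 j : s j <= 1.
  by rewrite -lee_fin fineK; [exact/probability_le1/mpre|exact/fP/mpre].
have wt0 K : 0 <= wt K.
  by apply: prodr_ge0 => j _; case: ifP => _ //; rewrite subr_ge0.
have PC (K : {set I}) i : i \in K -> (P (C K i) <= (b / #|K|%:R * wt K)%:E)%E.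
  move=> iK; rewrite indX //.
  have fY j : P (X j @^-1` Y K i j) = (fine (P (X j @^-1` Y K i j)))%:E.
    by rewrite fineK//; exact/fP/mpre.
  under eq_bigr do rewrite fY.
  rewrite (eq_bigl xpredT) => [|j]; last by rewrite inE.
  rewrite prodEFin lee_fin /wt (bigD1 i) //= [X in _ <= _ * X](bigD1 i) //=.
  rewrite iK mulrA ler_pM ?fine_ge0 //.
  - by apply: prodr_ge0 => j _; exact: fine_ge0.
  - by rewrite /Y eqxx; apply: leDB; apply/card_gt0P; exists i.
  apply: ler_prod => j ji; rewrite fine_ge0 //= /Y (negbTE ji).
  case: ifP => // _; rewrite preimage_setC probability_setC; last exact: mpre.
  by rewrite fineB ?fP //; exact: mpre.
pose W := \big[setU/set0]_(K : {set I}) \big[setU/set0]_(i in K) C K i.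
have EsubW : E `<=` W.
  move=> w /EW[i Bi Di]; set K := [set j | _]%SET in Di.
  have iK : i \in K by rewrite inE; exact: mem_set.
  rewrite /W (bigD1 K) //=; left; rewrite (bigD1 i) //=; left=> j _.
  rewrite /= /Y; case: eqP => [->//|_]; rewrite inE.
  by case: ifPn => [/set_mem//|/negP BXj Bj]; apply: BXj; exact: mem_set.
apply: (le_trans (le_measure _ _ _ EsubW)); rewrite ?inE //.
  by apply: bigsetU_measurable => K _; exact: bigsetU_measurable.
apply: le_trans.
  by apply: measure_bigsetU_le => K; exact: bigsetU_measurable.
apply: (@le_trans _ _ (\sum_(K : {set I}) (b * wt K)%:E)%E).
  apply: lee_sum => K _; apply: le_trans; first exact: measure_bigsetU_le.
  apply: (@le_trans _ _ (\sum_(i in K) (b / #|K|%:R * wt K)%:E)%E).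
    by apply: lee_sum => i; exact: PC.
  rewrite sumEFin lee_fin sumr_const -[leLHS]mulr_natl.
  (* The [#|K|] equal terms cancel the denominator; an empty [K] contributes nothing. *)
  have [->|K0] := eqVneq #|K| 0%N; first by rewrite mul0r mulr_ge0.
  by rewrite mulrA mulrCA divff ?pnatr_eq0 // mulr1.
rewrite sumEFin lee_fin -mulr_sumr ler_piMr //.
(* The weights over all subsets are the expansion of the product of the factors [s j + (1 - s j)],
   so they sum to 1. *)
rewrite -(bigA_distr 1 +%R s (fun j => 1 - s j)) big1 // => j _.
by rewrite /= addrC subrK.
Qed.

(** * Laws of the p-values under A.1 and A.2 *)

Lemma measurable_le_cst {d} {T : measurableType d} {R : realType}
    (f : T -> R) (x : R) :
  measurable_fun [set: T] f -> measurable [set w | f w <= x].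
Proof.
move=> mf; rewrite (_ : mkset _ = f @^-1` [set` `]-oo, x]]).
  by apply: measurable_preimage => //; exact: measurable_itv.
by apply/seteqP; split=> w; rewrite /= in_itv.
Qed.

Lemma measurable_lt_cst {d} {T : measurableType d} {R : realType}
    (f : T -> R) (x : R) :
  measurable_fun [set: T] f -> measurable [set w | f w < x].
Proof.
move=> mf; rewrite (_ : mkset _ = f @^-1` [set` `]-oo, x[]).
  by apply: measurable_preimage => //; exact: measurable_itv.
by apply/seteqP; split=> w; rewrite /= in_itv.
Qed.

(** The uniform law has no atoms: [X < x] contains [X <= x - e] for every [e > 0], which has
    probability [x - e] when this is nonnegative. *)
Lemma uniform_lt {d} {T : measurableType d} {R : realType}
    (P : probability T R) (X : T -> R) (x : R) :
  measurable_fun [set: T] X ->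
  (forall y, 0 <= y <= 1 -> P [set w | X w <= y] = y%:E) ->
  0 <= x <= 1 -> P [set w | X w < x] = x%:E.
Proof.
move=> mX unifX /andP[x0 x1].
have mlt : measurable [set w | X w < x] by exact: measurable_lt_cst.
have mle y : measurable [set w | X w <= y] by exact: measurable_le_cst.
apply/eqP; rewrite eq_le; apply/andP; split.
  rewrite -unifX ?x0//; apply: le_measure; rewrite ?inE //.
  by move=> w /= /ltW.
rewrite -(@fineK _ (P _)) ?fin_num_measure // lee_fin.
apply/ler_addgt0Pr => e e0; rewrite -lerBlDr.
have [xe|xe] := ltP (x - e) 0.
  by apply: (le_trans (ltW xe)); rewrite fine_ge0.
rewrite -lee_fin fineK ?fin_num_measure // -unifX; last first.
  by rewrite xe /= (le_trans _ x1) // gerBl ltW.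
apply: le_measure; rewrite ?inE // => w /= Xw.
by apply: le_lt_trans Xw _; rewrite ltrBlDr ltrDl.
Qed.

Lemma measurable_F0 {R : realType} {n : nat} (M : testing_model R n) i :
  measurable_fun [set: R] (F M i 0).
Proof. by apply: continuous_measurable_fun; exact: F0_continuous. Qed.

(** The p-value as a function of the value [t] of the statistic: events on p-values become preimages
    under [stat], the form in which independence is stated. *)
Definition select_cdf {R : realType} {n : nat} (M : testing_model R n)
    (h : hyp n) (t : R) : R :=
  if h.2 then F M h.1 0 t else 1 - F M h.1 0 t.

Lemma measurable_select_cdf {R : realType} {n : nat}
    (M : testing_model R n) h : measurable_fun [set: R] (select_cdf M h).
Proof.
rewrite /select_cdf; case: h.2; first exact: measurable_F0.
by apply: measurable_funB; [exact: measurable_cst|exact: measurable_F0].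
Qed.

Lemma measurable_pvalue {R : realType} {n : nat} (M : testing_model R n) h :
  measurable_fun [set: Omega M] (pvalue h).
Proof.
exact: (measurableT_comp (measurable_select_cdf M h)
  (measurable_funPT (stat M h.1))).
Qed.

(* A.1 gives uniformity at 0 only for [H_i1], the one that holds there, whereas
   the right-hand side of A.2 may also involve the p-value of [H_i2]. *)
Lemma pvalue_uniform {R : realType} {n : nat} (M : testing_model R n)
    (theta : 'I_n -> R) (h : hyp n) (p : R) :
  A1 M -> theta h.1 = 0 -> 0 <= p <= 1 ->
  Pr M theta [set w | pvalue h w <= p] = p%:E.
Proof.
case: h => i b HA1 /= t0.
have unif q : 0 <= q <= 1 ->
    Pr M theta [set w | pvalue (i, false) w <= q] = q%:E.
  move=> /(HA1 theta i)[_ /(_ t0)].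
  by rewrite /pvalue_le /true_pvalue /true_hyp t0 lexx.
case: b => p01; last exact: unif.
(* The two p-values at [i] sum to 1. *)
rewrite (_ : mkset _ = ~` [set w | pvalue (i, false) w < 1 - p]).
  rewrite probability_setC; last exact/measurable_lt_cst/measurable_pvalue.
  rewrite (uniform_lt _ _ _ _ unif) //; first by rewrite -EFinB subKr.
    exact: measurable_pvalue.
  by move: p01; lra.
by apply/seteqP; split=> w; rewrite /pvalue /=;
  [move=> ? /negP|move=> /negP]; rewrite -?leNgt; lra.
Qed.

(** With [theta0] the zero vector, the right-hand side of A.2 is [p / q] by uniformity. The
    cross-multiplied form also covers a conditioning event of probability zero, where both sides
    vanish. *)
Lemma true_pvalue_ratio {R : realType} {n : nat} (M : testing_model R n)
    (theta : 'I_n -> R) (i : 'I_n) (p q : R) :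
  A1 M -> A2 M -> 0 <= p -> p <= q -> q <= 1 ->
  fine (Pr M theta (pvalue_le M theta i p)) * q <=
    p * fine (Pr M theta (pvalue_le M theta i q)).
Proof.
move=> HA1 HA2 p0 pq q1.
have mle x : measurable (pvalue_le M theta i x).
  exact/measurable_le_cst/measurable_pvalue.
have sub : pvalue_le M theta i p `<=` pvalue_le M theta i q.
  by move=> w /= /le_trans; apply.
have [q0|q0] := eqVneq q 0.
  by rewrite q0 mulr0 mulr_ge0 // fine_ge0.
have qgt0 : 0 < q by rewrite lt_neqAle eq_sym q0 (le_trans p0).
pose Pq := Pr M theta (pvalue_le M theta i q).
have [Pq0|Pq0] := eqVneq Pq 0%E.
  rewrite (_ : Pr M theta (pvalue_le M theta i p) = 0%E).
    by rewrite /= mul0r mulr_ge0 // fine_ge0.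
  apply/eqP; rewrite eq_le measure_ge0 andbT -Pq0.
  by apply: le_measure; rewrite ?inE.
have Pqgt0 : (0 < Pq)%E by rewrite lt0e Pq0 measure_ge0.
have h1 : (true_hyp theta i).1 = i by rewrite /true_hyp; case: ifP.
have unif x : 0 <= x <= 1 -> Pr M (fun=> 0) (pvalue_le M theta i x) = x%:E.
  exact: pvalue_uniform.
have := HA2 theta (fun=> 0) i p q erefl p0 pq q1 Pqgt0.
rewrite unif ?(ltW qgt0) // lte_fin => /(_ qgt0).
rewrite /cond_pr (setIidl sub) !unif ?p0 ?(ltW qgt0) ?(le_trans pq) //=.
have fPq : 0 < fine Pq by rewrite fine_gt0 // Pqgt0 ltey_eq fin_num_measure.
by rewrite ler_pdivrMr // mulrAC ler_pdivlMr.
Qed.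

(** The strict inequality is the one that defines [K]: a false p-value [1 - P_i] is at most [c]
    exactly when [P_i < 1 - c] fails. *)
Lemma true_pvalue_ratio_lt {R : realType} {n : nat} (M : testing_model R n)
    (theta : 'I_n -> R) (i : 'I_n) (p q : R) :
  A1 M -> A2 M -> 0 <= p -> p < q -> q <= 1 ->
  fine (Pr M theta (pvalue_le M theta i p)) * q <=
    p * fine (Pr M theta [set w | true_pvalue theta i w < q]).
Proof.
move=> HA1 HA2 p0 pq q1.
have mle x : measurable (pvalue_le M theta i x).
  exact/measurable_le_cst/measurable_pvalue.
have mlt x : measurable [set w | true_pvalue (M := M) theta i w < x].
  exact/measurable_lt_cst/measurable_pvalue.
set f := fine _; set g := fine _.
have f0 : 0 <= f by exact: fine_ge0.
have f1 : f <= 1.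
  by rewrite -lee_fin fineK ?fin_num_measure //; exact: probability_le1.
have key x : p <= x -> x < q -> f * x <= p * g.
  move=> px xq.
  have x1 : x <= 1 by rewrite (le_trans (ltW xq)).
  apply: (le_trans (true_pvalue_ratio M theta i p x HA1 HA2 p0 px x1)).
  apply: ler_wpM2l => //; rewrite fine_le ?fin_num_measure //.
  by apply: le_measure; rewrite ?inE // => w /= /le_lt_trans; apply.
(* [P_i] may have an atom at [q], so [q] is approached from below. *)
apply/ler_addgt0Pr => e e0.
have := key (Num.max p (q - e)).
rewrite le_max lexx gt_max pq ltrBlDr ltrDl e0 => /(_ isT isT) le_pg.
have : q - e <= Num.max p (q - e) by rewrite le_max lexx orbT.
(* Replacing the maximum by the smaller [q - e] gives [f * (q - e) <= p * g], and [f * e <= e] since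
   [f <= 1]. *)
by move: le_pg; nra.
Qed.

(** * The event of a true rejection *)

(** The outcome is fixed by two random finite sets: the stage 1 rejections [S] and, for given [S],
    the p-values below the stage 2 constant. Measurability is obtained by conditioning on one and
    then on the other. *)
Lemma measurable_FWER_event {R : realType} {n : nat} (M : testing_model R n)
    (a : R) (theta : 'I_n -> R) :
  measurable [set w | (1 <= V1 (M := M) (procedure1 a) theta w)%N].
Proof.
have mcst (b : bool) : measurable [set _ : Omega M | b].
  by case: b; [rewrite set_true|rewrite set_false].
have mp (x : R) h : measurable [set w : Omega M | pvalue h w <= x].
  exact/measurable_le_cst/measurable_pvalue.
pose V (S : {set hyp n}) := (0 < #|[set h in S | hyp_holds theta h]|)%N.
pose Q (S : {set hyp n}) : set (Omega M) := [set w |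
  V (if #|S| == n then S
     else S :|: (~: S :&: [set h | pvalue h w <= a / (n%:R - #|S|%:R)]))%SET].
rewrite (_ : mkset _ = [set w | Q [set h | pvalue h w <= a / n%:R]%SET w]).
  apply: measurable_finset_pred => [h|S]; first exact: mp.
  rewrite /Q; case: (#|S| == n) => //.
  exact: (measurable_finset_pred _
    (fun S' => [set _ | V (S :|: (~: S :&: S'))%SET])).
by apply/seteqP; split=> w; rewrite /Q /V /V1 /procedure1 /stage1 /=;
  case: (_ == n) => //; rewrite -setIdE.
Qed.

(** This is the deterministic part, for a fixed outcome [w]. The hypothesis [a < 1 - a / n%:R]
    ensures that a true p-value below either critical constant has its index in [K]. *)
Lemma procedure1_true_rejection {R : realType} {n : nat}
    (M : testing_model R n) (a : R) (theta : 'I_n -> R) (w : Omega M) :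
  0 < a -> a < 1 - a / n%:R ->
  (1 <= V1 (procedure1 a) theta w)%N ->
  exists2 i, true_pvalue theta i w < 1 - a / n%:R &
    true_pvalue theta i w <=
      a / #|[set j | (true_pvalue theta j w < 1 - a / n%:R)%R]%SET|%:R.
Proof.
move=> a0 ac; set c := a / n%:R; set K := [set j | _]%SET.
pose P j := true_pvalue theta j w.
have tE h : hyp_holds theta h -> h = true_hyp theta h.1.
  case: h => j [] /=; rewrite /hyp_holds /true_hyp /=; last by move=> ->.
  by rewrite ltNge => /negbTE ->.
(* [fh j] is the false hypothesis of the pair [j]. *)
pose fh j : hyp n := (j, ~~ (true_hyp theta j).2).
have fhE j : pvalue (fh j) w = 1 - P j.
  rewrite /P /fh /true_pvalue /true_hyp /pvalue /=.
  by case: (theta j <= 0) => //=; rewrite subKr.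
rewrite /V1 => /card_gt0P[h]; rewrite inE => /andP[hR hT].
have n0 : (0 < n)%N by exact: leq_ltn_trans (ltn_ord h.1).
have cle : c <= a by rewrite /c ler_pdivrMr ?ltr0n // ler_peMr ?ler1n // ltW.
have leK i k : (0 < k)%N -> (k <= n)%N -> P i <= c -> P i <= a / k%:R.
  move=> k0 kn /le_trans; apply; rewrite /c ler_pM2l //.
  by rewrite lef_pV2 ?posrE ?ltr0n // ler_nat.
(* If some true p-value falls at stage 1, its index works, because [#|K| <= n] gives
   [c <= a / #|K|]. *)
have [[i Pic]|noP] := pselect (exists i, P i <= c).
  have Pi1 : P i < 1 - c by apply: le_lt_trans (le_trans Pic cle) ac.
  exists i => //; apply: leK => //; last by rewrite -[X in (_ <= X)%N]card_ord max_card.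
  by apply/card_gt0P; exists i; rewrite inE.
have Pc j : c < P j by rewrite ltNge; apply/negP => ?; apply: noP; exists j.
pose R1 := stage1 a (fun h => pvalue h w).
have R1E : R1 = (fh @: (~: K))%SET.
  apply/setP => g; rewrite inE; apply/idP/imsetP => [gc|[j]].
    have [gT|gF] := boolP (hyp_holds theta g).
      by move: gc; rewrite (tE _ gT) leNgt; have := Pc g.1; rewrite /P /true_pvalue => ->.
    have gE : g = fh g.1.
      case: g gF {gc} => j b; rewrite /fh /hyp_holds /true_hyp /=.
      by case: b; case: (leP (theta j) 0).
    exists g.1 => //; rewrite !inE -leNgt.
    by move: gc; rewrite {1}gE fhE -/c; rewrite /P; lra.
  by rewrite !inE -leNgt => Pj ->; rewrite fhE -/c /P; lra.
have cR1 : (#|R1| + #|K| = n)%N.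
  rewrite R1E card_imset; last by move=> j k [].
  by rewrite addnC cardsC card_ord.
have hN : h \notin R1.
  by rewrite inE -ltNge (tE _ hT); exact: Pc.
(* The true rejection [h] must come from stage 2, so [r] differs from [n] and [K] is nonempty. *)
move: hR; rewrite /procedure1 -/R1; case: eqP => [_|r1]; first by rewrite (negbTE hN).
rewrite finset.in_setU (negbTE hN) /= finset.inE => /andP[_].
have -> : n%:R - #|R1|%:R = #|K|%:R :> R.
  by rewrite -{1}cR1 natrD addrAC subrr add0r.
have K0 : (0 < #|K|)%N by rewrite lt0n; apply/eqP => K0; move: cR1 r1; rewrite K0 addn0.
rewrite (tE _ hT) => PK; exists h.1 => //.
apply: (le_lt_trans PK); apply: le_lt_trans ac.
by rewrite ler_pdivrMr ?ltr0n // ler_peMr ?ler1n // ltW.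
Qed.

(** * Finite-sample and asymptotic control *)

Lemma procedure1_control {R : realType} {n : nat} (M : testing_model R n)
    (a : R) : 0 < a < 1 -> (1 <= n)%N -> A1 M -> A2 M -> A3 M ->
  strongly_controls_FWER M (procedure1 a) (a / (1 - a / n%:R)).
Proof.
move=> /andP[a0 a1] n0 HA1 HA2 HA3 theta; rewrite /FWER.
have mE := measurable_FWER_event M a theta.
set c := a / n%:R.
have c0 : 0 <= c by rewrite divr_ge0 // ltW.
have cle : c <= a by rewrite /c ler_pdivrMr ?ltr0n // ler_peMr ?ler1n // ltW.
have c1 : 0 < 1 - c by rewrite subr_gt0 (le_lt_trans cle).
have [ca|ac] := leP (1 - c) a.
  apply: (le_trans (probability_le1 _ mE)).
  by rewrite lee_fin ler_pdivlMr // mul1r.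
pose g j := select_cdf M (true_hyp theta j).
have h1 j : (true_hyp theta j).1 = j by rewrite /true_hyp; case: ifP.
have gE j w : g j (stat M j w) = true_pvalue theta j w.
  by rewrite /g /select_cdf /true_pvalue /pvalue h1.
(* Here [B j] says that [j] lies in [K], and [D j k] that [P_j] is at most the critical constant for
   [#|K| = k]. *)
apply: (@independent_stepdown_bound _ _ _ _ _ (stat M)
  (fun j => [set t | g j t < 1 - c]) (fun j k => [set t | g j t <= a / k%:R])).
- exact: HA3.
- by move=> i; apply: measurable_lt_cst; exact: measurable_select_cdf.
- by move=> i k; apply: measurable_le_cst; exact: measurable_select_cdf.
- by rewrite divr_ge0 // ltW.
- move=> i k k0.
  have ak : a / k%:R <= a by rewrite ler_pdivrMr ?ltr0n // ler_peMr ?ler1n // ltW.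
  have := true_pvalue_ratio_lt M theta i (a / k%:R) (1 - c) HA1 HA2
    (divr_ge0 (ltW a0) (ler0n _ _)) (le_lt_trans ak ac).
  rewrite gerBl c0 => /(_ isT).
  rewrite -ler_pdivlMr //.
  have -> : pvalue_le M theta i (a / k%:R) =
      stat M i @^-1` [set t | g i t <= a / k%:R].
    by apply/seteqP; split=> w; rewrite /= gE.
  have -> : [set w | true_pvalue (M := M) theta i w < 1 - c] =
      stat M i @^-1` [set t | g i t < 1 - c].
    by apply/seteqP; split=> w; rewrite /= gE.
  by move/le_trans; apply; rewrite mulrAC [a / k%:R / _]mulrAC.
- exact: mE.
- move=> w /(procedure1_true_rejection _ _ _ _ a0 ac)[i Pi1 PiK].
  exists i; rewrite /= gE //.
  rewrite (_ : [set j | _]%SET = [set j | (true_pvalue theta j w < 1 - c)%R]%SET) //.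
  by apply/setP => j; rewrite !inE -gE; apply/idP/idP => [/set_mem|/mem_set].
Qed.

(** The upper limit is an infimum of suprema over neighbourhoods of infinity, and the indices
    satisfying the bound form one. *)
Lemma limn_esup_le {R : realType} (u : (\bar R)^nat) (l : \bar R) :
  (\forall n \near \oo, (u n <= l)%E) -> (limn_esup u <= l)%E.
Proof.
move=> ul; apply: (@le_trans _ _ (ereal_sup (u @` [set n | (u n <= l)%E]))).
  by apply: ereal_inf_lbound; exists [set n | (u n <= l)%E].
by apply: ge_ereal_sup => _ [n un <-].
Qed.

Theorem theorem1 (R : realType) (alpha : R) (halpha : 0 < alpha < 1) :
  (forall (n : nat) (M : testing_model R n), (1 <= n)%N ->
     A1 M -> A2 M -> A3 M ->
     strongly_controls_FWER M (procedure1 alpha)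
       (alpha / (1 - alpha / n%:R)))
  /\
  ((forall (M : forall n : nat, testing_model R n)
      (theta : forall n : nat, 'I_n -> R),
      (forall n : nat, (1 <= n)%N -> [/\ A1 (M n), A2 (M n) & A3 (M n)]) ->
      (limn_esup (fun n : nat => FWER (M n) (procedure1 alpha) (theta n))
         <= alpha%:E)%E)
   /\
   (forall (n : nat) (M : testing_model R n), (1 <= n)%N ->
      A1 M -> A2 M -> A3 M ->
      strongly_controls_FWER M (procedure1 (alpha / (1 + alpha / n%:R)))
        alpha)).
Proof.
have /andP[a0 a1] := halpha.
split; first by move=> n M n0; exact: procedure1_control.
split=> [M theta HM|n M n0 HA1 HA2 HA3].
  apply/lee_addgt0Pr => e e0; apply: limn_esup_le.
  near=> n.
  have n0 : (0 < n)%N by near: n; exact: nbhs_infty_gt.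
  have [HA1 HA2 HA3] := HM n n0.
  apply: (le_trans (procedure1_control _ _ halpha n0 HA1 HA2 HA3 (theta n))).
  have nR : 0 < n%:R :> R by rewrite ltr0n.
  have an : alpha / n%:R < 1 by rewrite ltr_pdivrMr // mul1r (lt_le_trans a1) // ler1n.
  rewrite -EFinD lee_fin ler_pdivrMr ?subr_gt0 //.
  (* This is [alpha <= (alpha + e) * (1 - alpha / n)] rearranged; it holds as soon as [n] is at
     least [(alpha + e) * alpha / e]. *)
  suff : (alpha + e) * (alpha / n%:R) <= e by lra.
  rewrite mulrA ler_pdivrMr // -ler_pdivrMl //.
  by near: n; exact: nbhs_infty_ger.
have nR : 0 < n%:R :> R by rewrite ltr0n.
have d1 : 1 < 1 + alpha / n%:R by rewrite ltrDl divr_gt0.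
have d0 : 0 < 1 + alpha / n%:R by exact: lt_trans d1.
set a' := alpha / (1 + alpha / n%:R).
have a'01 : 0 < a' < 1.
  by rewrite divr_gt0 //= ltr_pdivrMr // mul1r (lt_trans a1).
rewrite [X in strongly_controls_FWER _ _ X](_ : _ = a' / (1 - a' / n%:R)).
  exact: procedure1_control.
rewrite /a'; field.
by rewrite !gt_eqF //=; nra.
Unshelve. all: by end_near.
Qed.
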